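(* Let $n \ge 2$ be an integer and let $p_0, p_1$ be positive integers. Then there exists a convex $n$-dimensional rational polytope $\mathcal{P} \subset \mathbb{R}^n$ whose period sequence is $(p_0, p_1, 1, \dotsc, 1)$; that is, in its Ehrhart quasi-polynomial $\sum_{i=0}^{n} c_i(t)\,t^i$, the coefficient function $c_0$ has minimum period $p_0$, $c_1$ has minimum period $p_1$, and $c_i$ is constant for $2 \le i \le n$.
   Context: A rational polytope is a polytope all of whose vertices have rational coordinates. For an $n$-dimensional rational polytope $\mathcal{P} \subset \mathbb{R}^n$, the Ehrhart function $\mathrm{ehr}_{\mathcal{P}}(k) = |k\mathcal{P} \cap \mathbb{Z}^n|$ ($k \in \mathbb{Z}_{\ge 1}$) is a quasi-polynomial: $\mathrm{ehr}_{\mathcal{P}}(k) = \sum_{i=0}^n c_i(k) k^i$ for all integers $k \ge 1$, where each $c_i \colon \mathbb{Z} \to \mathbb{Q}$ is periodic (these coefficient functions are uniquely determined). The period sequence of $\mathcal{P}$ is $(p_0, \dotsc, p_n)$, where $p_i$ is the minimum positive integer with $c_i(k) = c_i(k+p_i)$ for all $k \in \mathbb{Z}$. *)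

(* Defs.v *)
From HB Require Import structures.
From mathcomp Require Import all_boot all_order all_algebra finmap.
From mathcomp Require Import boolp classical_sets functions cardinality reals.

Set Implicit Arguments.
Unset Strict Implicit.
Unset Printing Implicit Defensive.

Import Order.TTheory GRing.Theory Num.Theory.

Local Open Scope classical_set_scope.
Local Open Scope ring_scope.

Section Polytopes.
Variables (R : realType) (n : nat).
Implicit Types (A P : set 'rV[R]_n) (v x y : 'rV[R]_n).

Definition convex_hull A : set 'rV[R]_n :=
  [set x | exists m (v : 'I_m -> 'rV[R]_n) (a : 'I_m -> R),
    [/\ forall i, A (v i), forall i, 0 <= a i,
        \sum_(i < m) a i = 1 & x = \sum_(i < m) a i *: v i]].

Definition affine_hull A : set 'rV[R]_n :=
  [set x | exists m (v : 'I_m -> 'rV[R]_n) (a : 'I_m -> R),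
    [/\ forall i, A (v i),
        \sum_(i < m) a i = 1 & x = \sum_(i < m) a i *: v i]].

Definition polytope P : Prop :=
  exists V : set 'rV[R]_n, finite_set V /\ P = convex_hull V.

Definition vertex P v : Prop :=
  P v /\ forall x y (t : R), P x -> P y -> 0 < t < 1 ->
    v = t *: x + (1 - t) *: y -> x = v /\ y = v.

Definition rational_point x : Prop :=
  forall j, exists q : rat, x ord0 j = ratr q.

Definition rational_polytope P : Prop :=
  polytope P /\ forall v, vertex P v -> rational_point v.

Definition has_dim P (d : nat) : Prop :=
  exists (x0 : 'rV[R]_n) (U : {vspace 'rV[R]_n}),
    \dim U = d /\ affine_hull P = [set x0 + u | u in [set u | u \in U]].

Definition integer_points : set 'rV[R]_n :=
  [set x | forall j, x ord0 j \is a Num.int].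

Definition dilate (k : nat) P : set 'rV[R]_n := [set k%:R *: x | x in P].

(* [fset_set] sends infinite sets to [fset0]; a polytope is bounded, so the
   set counted here is finite whenever [P] is a polytope. *)
Definition ehrhart P (k : nat) : nat :=
  #|` fset_set (dilate k P `&` integer_points)|%fset.

End Polytopes.

Definition has_period (c : int -> rat) (p : nat) : Prop :=
  (0 < p)%N /\ forall k : int, c (k + p%:Z) = c k.

Definition min_period (c : int -> rat) (p : nat) : Prop :=
  has_period c p /\ forall q : nat, has_period c q -> (p <= q)%N.

Definition ehrhart_coefficients (R : realType) (n : nat) (P : set 'rV[R]_n)
    (c : 'I_n.+1 -> int -> rat) : Prop :=
  (forall i, exists p : nat, has_period (c i) p) /\
  (forall k : nat, (1 <= k)%N ->
     (ehrhart P k)%:R = \sum_(i < n.+1) c i k%:Z * k%:R ^+ i).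

(* At most one family [c] satisfies [ehrhart_coefficients P c]: on each residue
   class modulo a common period the values at large [k] determine a polynomial.
   The existential thus speaks about the coefficient functions of [P]. *)
Definition period_sequence (R : realType) (n : nat) (P : set 'rV[R]_n)
    (p : 'I_n.+1 -> nat) : Prop :=
  exists c : 'I_n.+1 -> int -> rat,
    ehrhart_coefficients P c /\ forall i, min_period (c i) (p i).

(* Main.v *)
(* Write p_1 = e + 1 and p_0 = q, and let the coordinates be (x, y, z) with
   z in R^(n-2).  The polytope below is chosen so that, after fixing z and
   putting m = k - |z|, the lattice points of its k-th dilate over z number
     k (2m + 1 - ceil(m / p_1)) + (quadratic in m) - sum_(t <= m) ceil(t / p_0).
   For n = 2 it consists of the rectangle [0, 1 + e/p_1] x [0, 1],
   whose rows 0 <= y < k of the dilate give the first term; above it, a strip of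
   width 1 with, on its right, a triangle which has a nonintegral vertex but a
   polynomial Ehrhart function (it is lattice-equidecomposable with an integral
   triangle); and the top left corner of the strip is cut off along a line of
   slope p_0, which gives the last term.
   In higher dimension, the points (0, 0, e_i) and (0, 1, e_i) are added.
   Summing over z amounts to taking n - 2 iterated partial sums, and partial
   summation turns "polynomial + p-periodic" into "polynomial + p-periodic"
   with the same minimal period.  The factor k, which does not depend on z, then
   puts the p_1-periodic function in c_1 only, and the p_0-periodic one stays in
   c_0. *)
Require Import Defs.
From mathcomp Require Import all_boot all_order all_algebra finmap.
From mathcomp Require Import boolp classical_sets cardinality reals.
From mathcomp Require Import zify ring lra.

Set Implicit Arguments.
Unset Strict Implicit.
Unset Printing Implicit Defensive.

Import Order.TTheory GRing.Theory Num.Theory.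

Local Open Scope classical_set_scope.
Local Open Scope ring_scope.

(** * Partial sums of polynomials and of polynomials plus a periodic term *)

Definition psum (f : nat -> rat) (k : nat) : rat := \sum_(m < k.+1) f m.

Lemma psumS f k : psum f k.+1 = psum f k + f k.+1.
Proof. by rewrite /psum big_ord_recr. Qed.

Lemma psum0 f : psum f 0 = f 0%N.
Proof. by rewrite /psum big_ord_recl big_ord0 addr0. Qed.

Definition polynomial_of_size (N : nat) (f : nat -> rat) : Prop :=
  exists P : {poly rat}, (size P <= N)%N /\ forall k : nat, f k = P.[k%:R].

Definition quasi_constant_period (N p : nat) (f : nat -> rat) : Prop :=
  exists (P : {poly rat}) (c : int -> rat),
    [/\ (size P <= N)%N, min_period c p &
        forall k : nat, f k = P.[k%:R] + c k%:Z].

Lemma psum_polynomial N f :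
  polynomial_of_size N f -> polynomial_of_size N.+1 (psum f).
Proof.
elim: N f => [|N IH] f [P [sP fP]].
  exists 0; rewrite size_poly0; split=> // k.
  have P0 : P = 0 by apply/eqP; rewrite -size_poly_eq0 -leqn0.
  by rewrite /psum big1 ?horner0 // => i _; rewrite fP P0 horner0.
(* The division by [N.+1] compensates the coefficient of degree [N] in
   ['X^(N.+1) - ('X - 1) ^+ N.+1], which is [N.+1]. *)
pose a := P`_N / N.+1%:R.
pose Q1 : {poly rat} := a *: 'X^(N.+1).
pose Q2 : {poly rat} := a *: ('X - 1%:P) ^+ N.+1.
pose P' := P - (Q1 - Q2).
have sX : size (('X - 1%:P : {poly rat}) ^+ N.+1) = N.+2.
  by rewrite size_exp_XsubC.
have sP' : (size P' <= N)%N.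
  apply/leq_sizeP => j; rewrite leq_eqVlt => /orP[/eqP <-|ltNj].
    rewrite /P' !coefB !coefZ coefXn.
    rewrite exprDn_comm; last exact: mulrC.
    rewrite coef_sum (bigD1 (inord 1)) //= inordK // subSS subn0.
    rewrite big1 => [|i ni1].
      rewrite addr0 expr1 bin1 coefMn -polyCN. rewrite coefMC coefXn eqxx.
      have -> : (N == N.+1) = false by lia.
      rewrite mul1r mulNrn /a mulr0 sub0r mulrN opprK divfK ?subrr //.
      by rewrite pnatr_eq0.
    rewrite coefMn -polyCN -rmorphXn coefMC coefXn.
    case: eqP => [E|_]; last by rewrite mul0r mul0rn.
    case/eqP: ni1; apply/val_inj; rewrite /= inordK //.
    by case: i E => i /= li E; lia.
  rewrite /P' !coefB (leq_sizeP _ _ sP) // !coefZ coefXn.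
  move: ltNj; rewrite leq_eqVlt => /orP[/eqP <-|ltNj].
    rewrite eqxx mulr1 sub0r.
    have -> : (('X - 1%:P : {poly rat}) ^+ N.+1)`_N.+1 = 1.
      have /monicP := monic_exp N.+1 (monicXsubC (1 : rat)).
      by rewrite /lead_coef sX.
    by rewrite mulr1 subrr oppr0.
  rewrite gtn_eqF // mulr0 (leq_sizeP _ _ (_ : _ <= N.+2)%N) ?sX //.
  by rewrite mulr0 !subr0.
(* Q1(k) - Q2(k) = Q1(k) - Q1(k - 1) has the same leading term as P, so that P'
   has smaller degree. *)
have [Q [sQ EQ]] := IH (fun k => P'.[k%:R]) (ex_intro _ P' (conj sP' (fun=> erefl))).
have sQ1 : (size Q1 <= N.+2)%N by rewrite (leq_trans (size_scale_leq _ _)) ?size_polyXn.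
exists (Q + Q1 - Q2.[0]%:P); split.
  rewrite (leq_trans (size_polyD _ _)) // geq_max.
  rewrite (leq_trans (size_polyD _ _)) ?geq_max ?sQ1 ?andbT ?(leq_trans sQ) //.
  by rewrite size_polyN (leq_trans (size_polyC_leq1 _)).
move=> k; have -> : psum f k = psum (fun k => P'.[k%:R]) k + (Q1.[k%:R] - Q2.[0]).
  elim: k => [|k IHk].
    rewrite !psum0 fP /P' mulr0n !(hornerD, hornerN); ring.
  rewrite !psumS IHk fP /P' !(hornerD, hornerN).
  have -> : Q2.[k.+1%:R] = Q1.[k%:R].
    by rewrite /Q1 /Q2 !hornerZ !horner_exp !hornerE -natr1 addrK.
  by ring.
by rewrite EQ !(hornerD, hornerN, hornerC) addrA.
Qed.

(** Write [c] as its mean [mu] plus [b]. The mean joins the polynomial part, and since [b] sums to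
    zero over a period, its partial sums [C] are again periodic. Conversely [b] is the difference
    sequence of [C], so a period of [C] is one of [c], which keeps the period minimal. *)
Lemma psum_quasi_constant_period N p f :
  (0 < N)%N -> quasi_constant_period N p f ->
  quasi_constant_period N.+1 p (psum f).
Proof.
move=> N_gt0 [P [c [sP [[p_gt0 cp] cmin] fP]]].
pose mu := (\sum_(j < p) c j%:Z) / p%:R.
have p0 : p%:R != 0 :> rat by rewrite pnatr_eq0 -lt0n.
pose rho (k : int) : nat := `|(k %% p%:Z)%Z|%N.
pose b (k : int) := c k - mu.
have rhoD k : rho (k + p%:Z) = rho k by rewrite /rho modzDr.
have rho_lt k : (rho k < p)%N.
  have := ltz_pmod k (_ : 0 < p%:Z); rewrite ltz_nat p_gt0 => /(_ isT).
  have := modz_ge0 k (_ : p%:Z != 0); rewrite /rho eqz_nat -lt0n p_gt0 => /(_ isT).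
  lia.
have rhoE k : ((rho k)%:Z = k %% p%:Z)%Z.
  by rewrite /rho gez0_abs // modz_ge0 // eqz_nat -lt0n.
have cMz (z : int) k : c (k + z * p%:Z) = c k.
  have cMn (n : nat) k' : c (k' + n%:Z * p%:Z) = c k'.
    elim: n k' => [|n IHn] k'; first by rewrite mul0r addr0.
    by rewrite intS mulrDl mul1r addrA IHn cp.
  case: z => n; first exact: cMn.
  by rewrite -[LHS](cMn n.+1) NegzE mulNr subrK.
have crho k : c (rho k)%:Z = c k.
  by rewrite rhoE [in RHS](divz_eq k p%:Z) addrC cMz.
have sumb : \sum_(j < p) b j%:Z = 0.
  by rewrite sumrB sumr_const card_ord -mulr_natr /mu divfK ?subrr.
(* Summing only up to the residue of [k] makes [C] periodic on all of [int] by construction. *)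
pose C (k : int) := \sum_(j < (rho k).+1) b j%:Z.
(* The only delicate case is the wrap-around [rho k = p - 1], where [C k] is a full-period sum and
   vanishes by [sumb]. *)
have Cdiff k : C (k + 1) = C k + b (k + 1).
  have [E|E] := eqVneq (rho k).+1 p.
    have r0 : rho (k + 1) = 0%N.
      apply/eqP; rewrite -eqz_nat rhoE -modzDml -(rhoE k).
      by rewrite -[1]/(1%:Z) -PoszD addn1 E modzz.
    by rewrite /C r0 E sumb big_ord_recl big_ord0 addr0 add0r /b -(crho (k + 1)) r0.
  have r1 : rho (k + 1) = (rho k).+1.
    apply/eqP; rewrite -eqz_nat rhoE -modzDml -(rhoE k).
    by rewrite -[1]/(1%:Z) -PoszD addn1 modz_small // ltz_nat /= ltn_neqAle E rho_lt.
  by rewrite /C r1 big_ord_recr /= /b -(crho (k + 1)) r1.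
have sPmu : (size (P + mu%:P)%R <= N)%N.
  rewrite (leq_trans (size_polyD _ _)) // geq_max sP.
  by rewrite (leq_trans (size_polyC_leq1 _)).
have [Q [sQ EQ]] : polynomial_of_size N.+1 (psum (fun k => (P + mu%:P).[k%:R])).
  by apply: psum_polynomial; exists (P + mu%:P).
exists Q, C; split=> //.
  split; first by split=> // k; rewrite /C rhoD.
  move=> q [q_gt0 Cq]; apply: cmin; split=> // k.
  have bE k' : b k' = C k' - C (k' - 1) by rewrite -{2}[k'](subrK 1) Cdiff subrK addrC addKr.
  apply: (addIr (- mu)); rewrite -/(b k) -/(b (k + q%:Z)) !bE Cq.
  by rewrite addrAC Cq.
move=> k; rewrite -EQ; elim: k => [|k IHk].
  rewrite !psum0 fP /C (_ : rho 0 = 0%N) ?big_ord_recl ?big_ord0; last first.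
    by rewrite /rho mod0z.
  by rewrite hornerD hornerC /b; ring.
rewrite !psumS IHk fP -[k.+1]addn1 PoszD Cdiff hornerD hornerC /b.
by ring.
Qed.

(** * Ceilings and floor sums *)

Definition cdiv (m p : nat) : nat := (m + p.-1) %/ p.

Lemma cdiv_leq m p x : (0 < p)%N -> (cdiv m p <= x)%N = (m <= p * x)%N.
Proof.
move=> p_gt0; rewrite /cdiv -ltnS ltn_divLR // mulSn mulnC.
by apply/idP/idP; lia.
Qed.

(** Rounding [k] up to a multiple of [p] adds [(- k) mod p]. This residue vanishes at 0, so it
    vanishes at any period [q], and [p] divides [q]. *)
Lemma cdiv_quasi_constant_period p : (0 < p)%N ->
  quasi_constant_period 2 p (fun k => (cdiv k p)%:R).
Proof.
move=> p_gt0.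
have p0 : p%:R != 0 :> rat by rewrite pnatr_eq0 -lt0n.
pose c (k : int) : rat := ((- k) %% p%:Z)%Z%:~R / p%:R.
exists (p%:R^-1 *: 'X), c; split.
- by rewrite (leq_trans (size_scale_leq _ _)) ?size_polyX.
- split.
    by split=> // k; rewrite /c opprD -[in LHS]modzDr subrK.
  move=> q [q_gt0 cq]; have := cq 0; rewrite add0r /c oppr0 mod0z mul0r.
  move/eqP; rewrite mulf_eq0 invr_eq0 (negbTE p0) orbF intr_eq0.
  by move=> /eqP/dvdz_mod0P; rewrite dvdzE abszN /=; exact: dvdn_leq.
move=> k; rewrite hornerZ hornerX /c.
have E : (cdiv k p)%:Z * p%:Z = k%:Z + ((- k%:Z) %% p%:Z)%Z.
  have H1 := divz_eq (- k%:Z) p%:Z; have H2 := ltz_pmod (- k%:Z) (p_gt0 : 0 < p%:Z).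
  have H3 := modz_ge0 (- k%:Z) (_ : p%:Z != 0).
  have {}H3 : (0 <= (- k%:Z) %% p%:Z)%Z by apply: H3; lia.
  have H4 := divn_eq (k + p.-1) p; have H5 := ltn_pmod (k + p.-1) p_gt0.
  rewrite -/(cdiv k p) in H4.
  set u := (_ %/ _)%Z in H1; set v := (_ %% _)%Z in H1 H2 H3 *.
  have Hu : u = - (cdiv k p)%:Z.
    by nia.
  rewrite Hu in H1; lia.
apply: (mulIf p0); rewrite mulrDl mulrAC mulVf // mul1r divfK //.
have /(congr1 (fun z : int => z%:~R : rat)) := E.
by rewrite intrM intrD -!pmulrn.
Qed.

(* The left-hand side is quasi-polynomial a priori: this is the collapse of the
   period in the triangular layer. *)
Lemma sum_mul_div_sq e m :
  (\sum_(w < (e.+1 * m).+1) ((e * w) %/ e.+1 ^ 2) = e * 'C(m, 2))%N.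
Proof.
elim: m => [|m IH]; first by rewrite muln0 big_ord_recl big_ord0 muln0 div0n.
(* Passing from [m] to [m.+1] adds a block of [e.+1] terms, whose sum has to be [e * m]. *)
have -> : ((e.+1 * m.+1).+1 = (e.+1 * m).+1 + e.+1)%N by rewrite mulnS; lia.
rewrite big_split_ord /= IH binS bin1 mulnDr; congr addn.
have ltb := ltn_pmod m (ltn0Sn e); set b := (m %% e.+1)%N in ltb.
have mE : (m = m %/ e.+1 * e.+1 + b)%N by exact: divn_eq.
set a := (m %/ e.+1)%N in mE.
(* In the block the floor is [m - a - 1] for the first [b] indices and [m - a] for the others; the
   total is [e.+1 * m - (e.+1 * a + b) = e * m]. *)
have step (i : nat) : (i < e.+1)%N ->
  ((e * ((e.+1 * m).+1 + i)) %/ e.+1 ^ 2 + (a + (i < b)%N) = m)%N.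
  move=> lti; rewrite expnS expn1; case: (ltnP i b) => [ltib|leqbi].
    have -> : (e * ((e.+1 * m).+1 + i) = (m - a - 1) * (e.+1 * e.+1) +
      (e.+1 * e.+1 + e * i.+1 - e.+1 * b))%N by rewrite !mE; nia.
    rewrite divnMDl ?muln_gt0 // divn_small; last by nia.
    by rewrite mE; nia.
  have -> : (e * ((e.+1 * m).+1 + i) = (m - a) * (e.+1 * e.+1) +
    (e * i.+1 - e.+1 * b))%N by rewrite !mE; nia.
  rewrite divnMDl ?muln_gt0 // divn_small; last by nia.
  by rewrite mE; nia.
have indE n : (\sum_(i < n) (i < b) = minn n b)%N.
  elim: n => [|n IHn]; first by rewrite big_ord0 min0n.
  by rewrite big_ord_recr /= IHn; lia.
have : (\sum_(i < e.+1) (e * ((e.+1 * m).+1 + i) %/ e.+1 ^ 2 + (a + (i < b))) =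
  e.+1 * m)%N.
  rewrite (eq_bigr (fun=> m)) => [|i _]; last exact: step.
  by rewrite sum_nat_const card_ord.
rewrite !big_split /= indE sum_nat_const card_ord.
rewrite (minn_idPr (ltnW ltb)). nia.
Qed.

(** * Enumeration of the coordinates z *)

Fixpoint bounded_seqs (d k : nat) : seq (seq nat) :=
  if d is d'.+1 then
    [seq i :: z | i <- iota 0 k.+1, z <- bounded_seqs d' (k - i)]
  else [:: [::]].

Lemma mem_bounded_seqs d k z :
  (z \in bounded_seqs d k) = (size z == d) && (sumn z <= k)%N.
Proof.
elim: d k z => [|d IH] k z; first by case: z.
apply/idP/idP => [/allpairsPdep[i [z' [+ + ->]]]|].
  by rewrite mem_iota IH /= eqSS => ? /andP[-> ?] /=; lia.
case: z => // i z; rewrite [size _]/= [sumn _]/= eqSS => /andP[sz le_k].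
apply/allpairsPdep; exists i, z; split=> //.
  by rewrite mem_iota; lia.
by rewrite IH sz /=; lia.
Qed.

Lemma bounded_seqs_uniq d k : uniq (bounded_seqs d k).
Proof.
elim: d k => [//|d IH] k.
apply: allpairs_uniq_dep => //; first exact: iota_uniq.
by move=> [i z] [j t] _ _ /= [-> ->].
Qed.

(** A first entry [i] leaves the same problem for [d - 1] and [k - i]; read in reverse order, the
    sum over [i] is one more partial sum. *)
Lemma sum_bounded_seqs d k (f : nat -> rat) :
  \sum_(z <- bounded_seqs d k) f (k - sumn z)%N = iter d psum f k.
Proof.
elim: d k => [|d IH] k; first by rewrite big_seq1 subn0.
rewrite big_allpairs_dep -[iota 0 k.+1]/(index_iota 0 k.+1).
rewrite -[RHS]/(psum (iter d psum f) k) /psum -(big_mkord xpredT (iter d psum f)).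
rewrite [RHS]big_nat_rev; apply: eq_bigr => i _; rewrite add0n subSS -IH.
by apply: eq_bigr => z _; rewrite /= subnDA.
Qed.

(* In the k-th dilate over z with m = k - |z|, the row at height y consists of
   the points with row_low <= x <= row_high; the truncated subtractions y - k
   and y - (k + e * m) vanish where the slanted facets are inactive. *)
Definition row_low (e q k m y : nat) : nat := cdiv (y - (k + e * m)) q.

Definition row_high (e k m y : nat) : nat :=
  (e.+1 * (e.*2.+1 * m) - e * (y - k)) %/ e.+1 ^ 2.

Definition row_size (e q k m y : nat) : nat :=
  (row_high e k m y).+1 - row_low e q k m y.

(** * Row sizes and their sum over one slice *)

Lemma row_size_low e q k m y : (y <= k)%N -> (0 < q)%N ->
  row_size e q k m y = (m + (e * m) %/ e.+1).+1.
Proof.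
move=> leyk q_gt0; rewrite /row_size /row_low /row_high.
have -> : (y - (k + e * m) = 0)%N by lia.
have -> : (y - k = 0)%N by lia.
have -> : cdiv 0 q = 0%N by rewrite /cdiv add0n divn_small // prednK.
rewrite muln0 !subn0.
rewrite expnS expn1 divnMl //.
have -> : (e.*2.+1 * m = m * e.+1 + e * m)%N by nia.
by rewrite divnMDl.
Qed.

(** Counting rows downwards from the top one, by [w], turns the right boundary into the summand of
    [sum_mul_div_sq] and the left one into [cdiv (m - w) q]. The latter is added on the left-hand
    side to avoid a truncated subtraction. *)
Lemma row_size_high e q k m w : (0 < q)%N -> (w <= e.+1 * m)%N ->
  (row_size e q k m (k + (e.+1 * m - w)) + cdiv (m - w) q =
   m.+1 + (e * w) %/ e.+1 ^ 2)%N.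
Proof.
move=> q_gt0 lew; rewrite /row_size /row_low /row_high addKn.
have -> : (k + (e.+1 * m - w) - (k + e * m) = m - w)%N by lia.
have -> : (e.+1 * (e.*2.+1 * m) - e * (e.+1 * m - w) =
  m * e.+1 ^ 2 + e * w)%N.
  by rewrite expnS expn1 -!muln2; nia.
rewrite divnMDl ?expn_gt0 //.
have : (cdiv (m - w) q <= m)%N by rewrite cdiv_leq //; nia.
by move: (cdiv _ _) (_ %/ _)%N => c f; lia.
Qed.

(** This is [e m / (e + 1) = m - m / (e + 1)] after rounding; it exhibits the ceiling of period
    [e.+1] in the lower rows. *)
Lemma mul_div_succ e m : ((e * m) %/ e.+1 + cdiv m e.+1 = m)%N.
Proof.
have E : (m = m %/ e.+1 * e.+1 + m %% e.+1)%N by exact: divn_eq.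
have := ltn_pmod m (ltn0Sn e).
move: (m %/ e.+1)%N (m %% e.+1)%N E => a b -> ltb; rewrite /cdiv /=.
case: b ltb => [|b] ltb.
  rewrite !addn0 mulnA mulnK // divnMDl // divn_small //; nia.
have -> : (e * (a * e.+1 + b.+1) = (e * a + b) * e.+1 + (e - b))%N by nia.
have -> : (a * e.+1 + b.+1 + e = (a + 1) * e.+1 + b)%N by nia.
by rewrite !divnMDl // !divn_small //; nia.
Qed.

(** The [k] rows with [y < k] have equal size and give the first term; the remaining [(e.+1 * m).+1]
    rows are summed from the top. *)
Lemma sum_row_size e q k m : (0 < q)%N ->
  (\sum_(y < (k + e.+1 * m).+1) row_size e q k m y)%:R =
  k%:R * (2 * m%:R + 1 - (cdiv m e.+1)%:R)
  + ((e.+1 * m).+1 * m.+1 + e * 'C(m, 2))%:R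
  - psum (fun t => (cdiv t q)%:R) m :> rat.
Proof.
move=> q_gt0; rewrite -addnS big_split_ord /= natrD -addrA; congr (_ + _).
  rewrite (eq_bigr (fun=> (m + (e * m) %/ e.+1).+1)); last first.
    by move=> i _; rewrite row_size_low // ltnW.
  rewrite sum_nat_const card_ord natrM; congr (_ * _).
  have : ((e * m) %/ e.+1)%:R + (cdiv m e.+1)%:R = m%:R :> rat.
    by rewrite -natrD mul_div_succ.
  by rewrite -natr1 natrD; lra.
apply: (addIr (psum (fun t => (cdiv t q)%:R) m)); rewrite subrK.
have -> : psum (fun t => (cdiv t q)%:R) m =
    (\sum_(w < (e.+1 * m).+1) cdiv (m - w) q)%:R.
  (* For [w > m] the truncated [m - w] is 0, so only the top rows are shortened by the cut
     corner. *)
  rewrite -(subnKC (_ : m.+1 <= (e.+1 * m).+1)%N); last by nia.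
  rewrite big_split_ord /= [X in (_ + X)%N]big1 => [|i _]; last first.
    by rewrite (_ : m - (m.+1 + i) = 0)%N /cdiv ?divn_small //; lia.
  rewrite addn0 natr_sum /psum (reindex_inj rev_ord_inj) /=.
  by apply: eq_bigr => i _; rewrite subSS.
rewrite -natrD; congr (_%:R).
rewrite (reindex_inj rev_ord_inj) /= -big_split /=.
rewrite (eq_bigr (fun w : 'I__ => (m.+1 + (e * w) %/ e.+1 ^ 2)%N)); last first.
  by move=> w _; rewrite subSS row_size_high // -ltnS.
by rewrite big_split /= sum_mul_div_sq sum_nat_const card_ord.
Qed.

(** * Convex hulls and their vertices *)

Section ConvexHull.
Variables (R : realType) (n : nat).
Implicit Types (A : set 'rV[R]_n) (u v : 'rV[R]_n).

Lemma convex_hull_fin A (I : finType) (u : I -> 'rV[R]_n) (a : I -> R) :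
  (forall i, A (u i)) -> (forall i, 0 <= a i) -> \sum_i a i = 1 ->
  convex_hull A (\sum_i a i *: u i).
Proof.
move=> Au a_ge0 suma.
exists #|I|, (fun i => u (enum_val i)), (fun i => a (enum_val i)); split=> //.
  by rewrite -suma [RHS](reindex _ (onW_bij _ (@enum_val_bij I))).
by rewrite [LHS](reindex _ (onW_bij _ (@enum_val_bij I))).
Qed.

Lemma sub_convex_hull A : A `<=` convex_hull A.
Proof.
move=> v Av; exists 1%N, (fun=> v), (fun=> 1).
by rewrite !big_ord_recl !big_ord0 !addr0 scale1r.
Qed.

(** Expand every [u i] as a convex combination and multiply the weights; dependent pairs index the
    resulting combination. *)
Lemma convex_hull_idem A m (u : 'I_m -> 'rV[R]_n) (a : 'I_m -> R) :
  (forall i, convex_hull A (u i)) -> (forall i, 0 <= a i) ->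
  \sum_i a i = 1 -> convex_hull A (\sum_i a i *: u i).
Proof.
move=> Au a_ge0 suma.
have /boolp.choice[f fP] : forall i, exists w : {l : nat & ('I_l -> 'rV[R]_n) * ('I_l -> R)}%type,
    [/\ forall j, A ((tagged w).1 j), forall j, 0 <= (tagged w).2 j,
     \sum_j (tagged w).2 j = 1 & u i = \sum_j (tagged w).2 j *: (tagged w).1 j].
  by move=> i; have [l [w [b ?]]] := Au i; exists (existT _ l (w, b)).
pose I : finType := {i : 'I_m & 'I_(tag (f i))}.
pose w (p : I) := (tagged (f (tag p))).1 (tagged p).
pose b (p : I) := a (tag p) * (tagged (f (tag p))).2 (tagged p).
have -> : \sum_i a i *: u i = \sum_(p : I) b p *: w p.
  transitivity (\sum_i \sum_(j < tag (f i))
      (a i * (tagged (f i)).2 j) *: (tagged (f i)).1 j).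
    apply: eq_bigr => i _; have [_ _ _ ->] := fP i.
    by rewrite scaler_sumr; apply: eq_bigr => j _; rewrite scalerA.
  by rewrite sig_big_dep.
apply: convex_hull_fin.
- by move=> p; have [+ _ _ _] := fP (tag p); apply.
- by move=> p; rewrite mulr_ge0 //; have [_ + _ _] := fP (tag p); apply.
transitivity (\sum_i \sum_(j < tag (f i)) a i * (tagged (f i)).2 j).
  by rewrite sig_big_dep.
rewrite -suma; apply: eq_bigr => i _.
by rewrite -mulr_sumr; have [_ _ -> _] := fP i; rewrite mulr1.
Qed.

Lemma convex_hull_segment A u v (t : R) : convex_hull A u -> convex_hull A v ->
  0 <= t <= 1 -> convex_hull A (t *: u + (1 - t) *: v).
Proof.
move=> Au Av /andP[t_ge0 t_le1].
have -> : t *: u + (1 - t) *: v = \sum_(i < 2)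
    (if i == ord0 then t else 1 - t) *: (if i == ord0 then u else v).
  by rewrite !big_ord_recl big_ord0 addr0.
apply: convex_hull_idem => [i|i|]; do ?by case: ifP; rewrite ?subr_ge0.
by rewrite !big_ord_recl big_ord0 addr0; rewrite /= addrC subrK.
Qed.

(** Pick a point [u i] of positive weight in a combination giving [v]. If the weight is 1, then
    [v = u i]; otherwise [v] lies strictly between [u i] and the renormalized rest [w], and
    extremality forces [u i = v]. *)
Lemma vertex_convex_hull A v : vertex (convex_hull A) v -> A v.
Proof.
move=> [[m [u [a [Au a_ge0 suma vE]]]] ext].
have [i ai_gt0] : exists i, 0 < a i.
  apply: contrapT => /forallNP na; have : \sum_i a i = 0.
    by apply: big1 => i _; apply/eqP; rewrite eq_le a_ge0 leNgt andbT; apply/negP.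
  by rewrite suma => /eqP; rewrite oner_eq0.
have sumD : \sum_(j | j != i) a j = 1 - a i.
  by rewrite -suma [in RHS](bigD1 i) //= [RHS]addrAC subrr add0r.
have [ai1|ai_neq1] := eqVneq (a i) 1.
  have a0 j : j != i -> a j = 0.
    move=> nji; have /eqP := sumD; rewrite ai1 subrr psumr_eq0 // => /allP.
    by move=> /(_ j (mem_index_enum _)); rewrite nji => /eqP.
  have -> : v = u i; last exact: Au.
  rewrite vE (bigD1 i) //= ai1 scale1r big1 ?addr0 // => j /a0 ->.
  by rewrite scale0r.
have ai_lt1 : a i < 1.
  rewrite lt_neqAle ai_neq1 -subr_ge0 -sumD.
  by apply: sumr_ge0 => j _.
have c0 : 1 - a i != 0 by rewrite subr_eq0 eq_sym.
pose b j := if j == i then 0 else a j / (1 - a i).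
pose w := \sum_j b j *: u j.
have Pw : convex_hull A w.
  apply: convex_hull_fin => // [j|].
    rewrite /b; case: ifP => // _.
    by rewrite divr_ge0 // subr_ge0 ltW.
  rewrite (bigD1 i) //= /b eqxx add0r.
  rewrite (eq_bigr (fun j => a j / (1 - a i))) => [|j /negbTE -> //].
  by rewrite -mulr_suml sumD divff.
have vE' : v = a i *: u i + (1 - a i) *: w.
  rewrite vE (bigD1 i) //= /w [in RHS](bigD1 i) //= /b eqxx scale0r add0r.
  rewrite scaler_sumr; congr (_ + _); apply: eq_bigr => j /negbTE ->.
  by rewrite scalerA mulrC divfK.
have [<- _] : u i = v /\ w = v.
  by apply: (ext _ _ (a i)) => //; [exact: sub_convex_hull | rewrite ai_gt0].
exact: Au.
Qed.

End ConvexHull.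

(** * The polytope: corners against facet inequalities *)

Section Polytope.
Variables (R : realType) (d e q : nat).
Hypothesis q_gt0 : (0 < q)%N.
Implicit Types (k m x y t : R) (z : nat -> R) (v : 'rV[R]_d.+2).

Definition row_point x y z : 'rV[R]_d.+2 :=
  \row_j match val j with 0 => x | 1 => y | i.+2 => z i end.

Definition unit_seq (i : nat) : nat -> R := fun j => (j == i)%:R.

Definition row_entry v (j : nat) : R := v ord0 (inord j).

Definition height k v : R := k - \sum_(i < d) row_entry v i.+2.

(* Facet inequalities homogenized by k: for (x, y, z) in the k-th dilate, with
   m = height k (x, y, z). *)
Definition slice k m x y : Prop :=
  [/\ 0 <= x, 0 <= y & y <= k + e.+1%:R * m] /\
  [/\ y <= k + e%:R * m + q%:R * x,
      e.+1%:R * x <= (2 * e%:R + 1) * m &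
      e.+1%:R ^+ 2 * x + e%:R * y <=
        e.+1%:R * (2 * e%:R + 1) * m + e%:R * k].

(** The cone over the polytope, with [k] as homogenizing coordinate. Closure under sums and
    nonnegative scaling handles convex combinations and dilates alike. *)
Definition cone k v : Prop :=
  [/\ forall i, (i < d)%N -> 0 <= row_entry v i.+2, 0 <= height k v
    & slice k (height k v) (row_entry v 0) (row_entry v 1)].

Definition zero_seq : nat -> R := fun=> 0.

(** The first six points run counterclockwise around the polygon of the planar case. Not all need be
    vertices, as (1, 1) shows for [e = 0]; it suffices that they generate the hull. *)
Definition corners : seq 'rV[R]_d.+2 :=
  [:: row_point 0 0 zero_seq; row_point ((2 * e%:R + 1) / e.+1%:R) 0 zero_seq;
      row_point ((2 * e%:R + 1) / e.+1%:R) 1 zero_seq; row_point 1 e.+2%:R zero_seq;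
      row_point q%:R^-1 e.+2%:R zero_seq; row_point 0 e.+1%:R zero_seq] ++
  [seq row_point 0 0 (unit_seq i) | i <- iota 0 d] ++
  [seq row_point 0 1 (unit_seq i) | i <- iota 0 d].

Definition body : set 'rV[R]_d.+2 := convex_hull [set` corners].

Lemma row_entry_point0 x y z : row_entry (row_point x y z) 0 = x.
Proof. by rewrite /row_entry mxE /= inordK. Qed.

Lemma row_entry_point1 x y z : row_entry (row_point x y z) 1 = y.
Proof. by rewrite /row_entry mxE /= inordK. Qed.

Lemma row_entry_pointS x y z i : (i < d)%N -> row_entry (row_point x y z) i.+2 = z i.
Proof. by move=> ltid; rewrite /row_entry mxE /= inordK. Qed.

Lemma eq_point x y z z' : (forall i, (i < d)%N -> z i = z' i) ->
  row_point x y z = row_point x y z'.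
Proof.
by move=> zz'; apply/rowP => -[[|[|j]] ltj]; rewrite !mxE //=; apply: zz'.
Qed.

Lemma row_point_entry v : row_point (row_entry v 0) (row_entry v 1) (fun i => row_entry v i.+2) = v.
Proof.
apply/rowP => -[j ltj]; rewrite mxE /row_entry /=.
by case: j ltj => [|[|j]] ltj; congr (v _ _); apply/val_inj; rewrite /= inordK.
Qed.

Lemma point_comb t t' x y z x' y' z' :
  t *: row_point x y z + t' *: row_point x' y' z' =
  row_point (t * x + t' * x') (t * y + t' * y') (fun i => t * z i + t' * z' i).
Proof. by apply/rowP => -[[|[|j]] ltj]; rewrite !mxE. Qed.

Lemma row_entryD v v' j : row_entry (v + v') j = row_entry v j + row_entry v' j.
Proof. by rewrite /row_entry mxE. Qed.

Lemma row_entryZ t v j : row_entry (t *: v) j = t * row_entry v j.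
Proof. by rewrite /row_entry mxE. Qed.

Lemma row_entry0 j : row_entry 0 j = 0.
Proof. by rewrite /row_entry mxE. Qed.

Lemma heightD k k' v v' : height (k + k') (v + v') = height k v + height k' v'.
Proof.
rewrite /height (eq_bigr (fun i : 'I_d => row_entry v i.+2 + row_entry v' i.+2)).
  by rewrite big_split /=; ring.
by move=> i _; rewrite row_entryD.
Qed.

Lemma heightZ t k v : height (t * k) (t *: v) = t * height k v.
Proof.
rewrite /height mulrBr mulr_sumr; congr (_ - _).
by apply: eq_bigr => i _; rewrite row_entryZ.
Qed.

Lemma cone0 : cone 0 0.
Proof.
have h0 : height 0 0 = 0 by rewrite /height big1 ?subr0 // => i _; rewrite row_entry0.
split=> [i _||]; rewrite ?h0 ?row_entry0 //.
by split; split; lra.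
Qed.

Lemma coneD k k' v v' : cone k v -> cone k' v' -> cone (k + k') (v + v').
Proof.
move=> [z_ge0 h_ge0 [[? ? ?] [? ? ?]]] [z'_ge0 h'_ge0 [[? ? ?] [? ? ?]]].
split=> [i ltid||]; rewrite ?heightD ?row_entryD.
- by rewrite addr_ge0 ?z_ge0 ?z'_ge0.
- by rewrite addr_ge0.
by split; split; lra.
Qed.

Lemma coneZ t k v : 0 <= t -> cone k v -> cone (t * k) (t *: v).
Proof.
move=> t_ge0 [z_ge0 h_ge0 [[? ? ?] [? ? ?]]].
split=> [i ltid||]; rewrite ?heightZ ?row_entryZ.
- by rewrite mulr_ge0 ?z_ge0.
- by rewrite mulr_ge0.
have mono a b : a <= b -> t * a <= t * b by move=> ?; rewrite ler_wpM2l.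
split; split; try (by rewrite mulr_ge0).
- by rewrite mulrCA -mulrDr; apply: mono.
- by rewrite !(mulrCA _ t) -!mulrDr; apply: mono.
- by rewrite !(mulrCA _ t); apply: mono.
- by rewrite !(mulrCA _ t) -!mulrDr; apply: mono.
Qed.

Lemma cone_sum (I : finType) (a : I -> R) (u : I -> 'rV[R]_d.+2) :
  (forall i, 0 <= a i) -> (forall i, cone 1 (u i)) ->
  cone (\sum_i a i) (\sum_i a i *: u i).
Proof.
move=> a_ge0 cu; apply: (big_ind2 cone); first exact: cone0.
  by move=> *; apply: coneD.
by move=> i _; rewrite -[a i in X in cone X]mulr1; apply: coneZ.
Qed.

Lemma height_zero_seq k x y : height k (row_point x y zero_seq) = k.
Proof.
by rewrite /height big1 ?subr0 // => i _; rewrite row_entry_pointS.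
Qed.

Lemma height_unit_seq k x y i : (i < d)%N ->
  height k (row_point x y (unit_seq i)) = k - 1.
Proof.
move=> ltid; rewrite /height (bigD1 (Ordinal ltid)) //= big1 => [|j nj].
  by rewrite row_entry_pointS // /unit_seq eqxx addr0.
by rewrite row_entry_pointS // /unit_seq; move: nj; rewrite -val_eqE => /negbTE ->.
Qed.

Lemma corners_cone v : v \in corners -> cone 1 v.
Proof.
have e_ge0 : 0 <= e%:R :> R by exact: ler0n.
have eS : e.+1%:R = e%:R + 1 :> R by rewrite natr1.
have eSS : e.+2%:R = e%:R + 2 :> R by rewrite -natr1 eS; ring.
have q_ge1 : 1 <= q%:R :> R by rewrite ler1n.
have q0 : q%:R != 0 :> R by rewrite pnatr_eq0 -lt0n.
have eS0 : e%:R + 1 != 0 :> R by rewrite natr1 pnatr_eq0.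
have flat x y : slice 1 1 x y -> cone 1 (row_point x y zero_seq).
  move=> sl; split=> [i ltid||]; rewrite ?height_zero_seq ?row_entry_point0 ?row_entry_point1 //.
  by rewrite row_entry_pointS.
have high i y : i \in iota 0 d -> 0 <= y <= 1 -> cone 1 (row_point 0 y (unit_seq i)).
  rewrite mem_iota add0n => /andP[_ ltid] /andP[y_ge0 y_le1].
  split=> [j ltjd||]; rewrite ?height_unit_seq ?row_entry_point0 ?row_entry_point1 ?subrr //.
    by rewrite row_entry_pointS // ler0n.
  by split; split; nra.
(* The products of the nonintegral coordinates with the facet coefficients are prepared here for the
   arithmetic tactics. *)
have rE : (e%:R + 1) * ((2 * e%:R + 1) / (e%:R + 1)) = 2 * e%:R + 1 :> R.
  by rewrite mulrC divfK.
have r_ge0 : 0 <= (2 * e%:R + 1) / (e%:R + 1) :> R by rewrite divr_ge0; lra.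
have rE2 : (e%:R + 1) ^+ 2 * ((2 * e%:R + 1) / (e%:R + 1)) =
    (e%:R + 1) * (2 * e%:R + 1) :> R by rewrite expr2 -mulrA rE.
have qr_ge0 : 0 <= q%:R * ((2 * e%:R + 1) / (e%:R + 1)) :> R.
  by rewrite mulr_ge0 //; lra.
have qE : q%:R * q%:R^-1 = 1 :> R by rewrite divff.
have q_inv0 : 0 <= q%:R^-1 :> R by rewrite invr_ge0; lra.
have q_inv1 : q%:R^-1 <= 1 :> R by rewrite invf_le1 //; lra.
have q_inv2 : (e%:R + 1) ^+ 2 * q%:R^-1 <= (e%:R + 1) ^+ 2 :> R.
  by rewrite ler_piMr // sqr_ge0.
rewrite !mem_cat !inE -!orbA.
move=> /orP[/eqP ->|]; first by apply: flat; rewrite /slice eS; split; split; nra.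
move=> /orP[/eqP ->|].
  apply: flat; rewrite /slice eS; move: rE rE2 r_ge0 qr_ge0; set r := (_ / _) => rE rE2 r_ge0 qr_ge0.
  by split; split; lra.
move=> /orP[/eqP ->|].
  apply: flat; rewrite /slice eS; move: rE rE2 r_ge0 qr_ge0; set r := (_ / _) => rE rE2 r_ge0 qr_ge0.
  by split; split; lra.
move=> /orP[/eqP ->|]; first by apply: flat; rewrite /slice eSS eS; split; split; nra.
move=> /orP[/eqP ->|]; first by apply: flat; rewrite /slice eSS eS; split; split; nra.
move=> /orP[/eqP ->|]; first by apply: flat; rewrite /slice eS; split; split; nra.
move=> /orP[].
  by move=> /mapP[i ii ->]; apply: high => //; rewrite lexx ler01.
by move=> /mapP[i ii ->]; apply: high => //; rewrite lexx ler01.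
Qed.

Lemma body_cone v : body v -> cone 1 v.
Proof.
move=> [m [u [a [Vu a_ge0 suma ->]]]]; rewrite -[X in cone X]suma.
by apply: cone_sum => // i; apply: corners_cone; exact: Vu.
Qed.

Lemma body_point_between x x1 x2 y z : body (row_point x1 y z) ->
  body (row_point x2 y z) -> x1 <= x <= x2 -> body (row_point x y z).
Proof.
move=> b1 b2 /andP[le1 le2].
have [eqx|neqx] := eqVneq x1 x2.
  suff -> : x = x1 by exact: b1.
  by apply: le_anti; rewrite le1 eqx le2.
have lt12 : 0 < x2 - x1 by rewrite subr_gt0 lt_neqAle neqx (le_trans le1).
pose t := (x2 - x) / (x2 - x1).
have t01 : 0 <= t <= 1.
  by rewrite /t divr_ge0 ?ler_pdivrMr //; lra.
have := convex_hull_segment b1 b2 t01; rewrite point_comb.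
rewrite (_ : t * x1 + (1 - t) * x2 = x); last first.
  by rewrite /t; field; rewrite gt_eqF.
rewrite (_ : t * y + (1 - t) * y = y); last by ring.
by rewrite (eq_point _ _ (z' := z)) // => i _; ring.
Qed.

(** By [body_point_between] it is enough to place the two ends of the horizontal row through the
    point on edges of the polygon. *)
Lemma slice_body x y : slice 1 1 x y -> body (row_point x y zero_seq).
Proof.
have e_ge0 : 0 <= e%:R :> R by exact: ler0n.
have eS : e.+1%:R = e%:R + 1 :> R by rewrite natr1.
have eSS : e.+2%:R = e%:R + 2 :> R by rewrite -natr1 eS; ring.
have q_ge1 : 1 <= q%:R :> R by rewrite ler1n.
have q0 : q%:R != 0 :> R by rewrite pnatr_eq0 -lt0n.
have eS0 : e%:R + 1 != 0 :> R by rewrite natr1 pnatr_eq0.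
have eS_gt0 : 0 < e%:R + 1 :> R by lra.
have seg x1 y1 x2 y2 t : row_point x1 y1 zero_seq \in corners ->
    row_point x2 y2 zero_seq \in corners -> 0 <= t <= 1 ->
    body (row_point (t * x1 + (1 - t) * x2) (t * y1 + (1 - t) * y2) zero_seq).
  move=> c1 c2 t01.
  have := convex_hull_segment (sub_convex_hull (c1 : [set` corners] _))
    (sub_convex_hull (c2 : [set` corners] _)) t01.
  by rewrite point_comb (eq_point _ _ (z' := zero_seq)) // /zero_seq => i _; ring.
move=> [[x_ge0 y_ge0 y_le] [y_leq x_le xy_le]].
(* Up to height 1 both edges are vertical. Above, the right edge joins [((2e + 1) / (e + 1), 1)] to
   [(1, e + 2)] with parameter [s], and the left edge turns at height [e + 1] towards
   [(1 / q, e + 2)]. *)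
have [y_le1|y_gt1] := lerP y 1.
  apply: (@body_point_between _ 0 ((2 * e%:R + 1) / e.+1%:R)).
  - have := @seg 0 e.+1%:R 0 0 (y / e.+1%:R).
    rewrite !mulr0 !addr0 divfK; last by rewrite eS.
    apply; rewrite ?mem_cat ?inE ?eqxx ?orbT //.
    by rewrite eS divr_ge0 ?ler_pdivrMr //; lra.
  - have := @seg ((2 * e%:R + 1) / e.+1%:R) 1 ((2 * e%:R + 1) / e.+1%:R) 0 y.
    rewrite -mulrDl subrKC mul1r mulr0 addr0 mulr1.
    apply; rewrite ?mem_cat ?inE ?eqxx ?orbT //.
    by apply/andP.
  by rewrite x_ge0 ler_pdivlMr eS // mulrC -eS; lra.
pose s := (y - 1) / e.+1%:R.
have sE : s * (e%:R + 1) = y - 1 by rewrite /s eS divfK.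
apply: (@body_point_between _ (if y <= e.+1%:R then 0 else (y - e.+1%:R) / q%:R)
   (s * 1 + (1 - s) * ((2 * e%:R + 1) / e.+1%:R))).
- case: ifP => [y_leS|/negbT]; last rewrite -ltNge => y_gtS.
    have := @seg 0 e.+1%:R 0 0 (y / e.+1%:R).
    rewrite !mulr0 !addr0 divfK; last by rewrite eS.
    apply; rewrite ?mem_cat ?inE ?eqxx ?orbT //.
    by rewrite eS divr_ge0 ?ler_pdivrMr //; lra.
  have := @seg q%:R^-1 e.+2%:R 0 e.+1%:R (y - e.+1%:R).
  rewrite mulr0 addr0 (_ : _ * e.+2%:R + _ = y); last by rewrite eSS eS; ring.
  apply; rewrite ?mem_cat ?inE ?eqxx ?orbT //.
  by apply/andP; lra.
- have := @seg 1 e.+2%:R ((2 * e%:R + 1) / e.+1%:R) 1 s.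
  rewrite (_ : s * e.+2%:R + (1 - s) * 1 = y); last by rewrite eSS; lra.
  apply; rewrite ?mem_cat ?inE ?eqxx ?orbT //.
  by rewrite /s eS divr_ge0 ?ler_pdivrMr //; lra.
apply/andP; split.
  case: ifP => // _; rewrite ler_pdivrMr; last by lra.
  by lra.
have rE : ((2 * e%:R + 1) / e.+1%:R) * e.+1%:R = 2 * e%:R + 1 :> R.
  by rewrite divfK // eS.
rewrite -(ler_pM2l (_ : 0 < e.+1%:R ^+ 2)); last by rewrite exprn_gt0 // eS.
move: rE xy_le; rewrite eS; set r := (_ / _) => rE xy_le.
by nra.
Qed.

Lemma sum_point_unit_seq (a : nat -> R) y :
  \sum_(i < d) a i *: row_point 0 y (unit_seq i) =
  row_point 0 ((\sum_(i < d) a i) * y) a.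
Proof.
apply/rowP => -[[|[|j]] ltj]; rewrite summxE mxE /=.
- by rewrite big1 // => i _; rewrite !mxE mulr0.
- by rewrite mulr_suml; apply: eq_bigr => i _; rewrite !mxE.
rewrite (bigD1 (Ordinal (ltj : (j < d)%N))) //= !mxE /= /unit_seq eqxx mulr1.
rewrite big1 ?addr0 // => i ni; rewrite !mxE /=.
by rewrite eq_sym (negbTE (ni : (i : nat) != j)) mulr0.
Qed.

(** The point is a convex combination of a polygon point [(X, Y, 0)] with weight [m] and of points
    [(0, y0, e_i)] with weights [z_i]. *)
Lemma cone_body v : cone 1 v -> body v.
Proof.
move=> [z_ge0 h_ge0 sl].
pose m := height 1 v; pose x := row_entry v 0; pose y := row_entry v 1.
rewrite -/m in h_ge0 sl; rewrite -/x -/y in sl.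
have sumz : \sum_(i < d) row_entry v i.+2 = 1 - m by rewrite /m /height opprB addrC subrK.
have e_ge0 : 0 <= e%:R :> R by exact: ler0n.
have q_ge0 : 0 <= q%:R :> R by exact: ler0n.
have eS : e.+1%:R = e%:R + 1 :> R by rewrite natr1.
(* The height [y] is shared out as follows: if [m = 0], then [x = 0] and [y0 = y]; if [y <= 1], then
   [Y = y0 = y]; otherwise [y0 = 1] and [Y] takes the excess [(y - 1) / m] above 1. *)
have [X [Y [y0 [sXY /andP[y0_ge0 y0_le1] xE yE]]]] : exists X Y y0,
    [/\ slice 1 1 X Y, 0 <= y0 <= 1, m * X = x & m * Y + (1 - m) * y0 = y].
  move: sl; rewrite /slice eS => -[[x_ge0 y_ge0 y_le] [y_leq x_le xy_le]].
  have [m0|m_gt0] : m = 0 \/ 0 < m.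
    by move: h_ge0; rewrite le_eqVlt => /predU1P[]; [left|right].
    have x0 : x = 0 by move: x_le; rewrite m0; nra.
    have y_le1 : y <= 1 by move: y_le; rewrite m0; lra.
    exists 0, y, y; rewrite m0 x0 y_ge0 y_le1 mul0r mul0r add0r subr0 mul1r.
    by split=> //; split; split; nra.
  have mK w : m * (w / m) = w by rewrite mulrCA divff ?gt_eqF // mulr1.
  have [y_le1|y_gt1] := lerP y 1.
    exists (x / m), y, y; rewrite y_ge0 y_le1 mK.
    split=> //; last by ring.
    have := mK x.
    have : 0 <= x / m by rewrite divr_ge0 // ltW.
    move: (x / m) => X X_ge0 XE.
    have X_le : (e%:R + 1) * X <= 2 * e%:R + 1.
      by rewrite -(ler_pM2l m_gt0) -[X in _ <= X]mulrC mulrCA XE.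
    split; split=> //; try lra; try nra.
  exists (x / m), (1 + (y - 1) / m), 1.
  have := mK x.
  have := mK (y - 1).
  have : 0 <= x / m by rewrite divr_ge0 // ltW.
  have : 0 <= (y - 1) / m by rewrite divr_ge0 ?ltW // subr_gt0.
  move: (x / m) ((y - 1) / m) => X u u_ge0 X_ge0 uE XE.
  rewrite ler01 lexx; split=> //; last by lra.
  have yE : y = m * u + 1 by lra.
  have cancel a b : m * a <= m * b -> a <= b by rewrite ler_pM2l.
  rewrite !mulr1; split; split=> //.
  - by lra.
  - by apply: cancel; lra.
  - by apply: cancel; rewrite -XE in y_leq; lra.
  - by apply: cancel; rewrite -XE in x_le; lra.
  - by apply: cancel; rewrite -XE yE in xy_le; lra.
have bQ : body (row_point X Y zero_seq) by exact: slice_body.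
have bz i : (i < d)%N -> body (row_point 0 y0 (unit_seq i)).
  move=> ltid.
  have c0 : row_point 0 0 (unit_seq i) \in corners.
    rewrite !mem_cat (map_f (fun i => row_point 0 0 (unit_seq i))) ?orbT //.
    by rewrite mem_iota.
  have c1 : row_point 0 1 (unit_seq i) \in corners.
    rewrite !mem_cat (map_f (fun i => row_point 0 1 (unit_seq i))) ?orbT //.
    by rewrite mem_iota.
  have y01 : 0 <= y0 <= 1 by rewrite y0_ge0.
  have := convex_hull_segment (sub_convex_hull (c1 : [set` corners] _))
    (sub_convex_hull (c0 : [set` corners] _)) y01.
  rewrite point_comb !mulr0 !addr0 mulr1.
  by rewrite (eq_point _ _ (z' := unit_seq i)) // => j _; ring.
pose a (i : 'I_d.+1) := if unlift ord0 i is Some j then row_entry v j.+2 else m.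
pose u (i : 'I_d.+1) := if unlift ord0 i is Some j
  then row_point 0 y0 (unit_seq j) else row_point X Y zero_seq.
have -> : v = \sum_i a i *: u i.
  rewrite big_ord_recl /a /u unlift_none.
  under eq_bigr do rewrite liftK.
  rewrite (sum_point_unit_seq (fun i => row_entry v i.+2)) sumz.
  rewrite -[X in _ = _ + X]scale1r point_comb.
  rewrite -[LHS]row_point_entry -/x -/y mulr0 addr0 mul1r xE yE.
  by apply: eq_point => i _; rewrite /zero_seq; ring.
apply: convex_hull_idem => [i|i|].
- by rewrite /u; case: unlift => [j|]; [exact: bz|exact: bQ].
- by rewrite /a; case: unlift => [j|]; [exact: z_ge0|exact: h_ge0].
rewrite big_ord_recl /a unlift_none; under eq_bigr do rewrite liftK.
by rewrite sumz subrKC.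
Qed.

Lemma bodyE v : body v <-> cone 1 v.
Proof. by split; [exact: body_cone|exact: cone_body]. Qed.

Lemma dilate_body (k : nat) v : (0 < k)%N -> dilate k body v <-> cone k%:R v.
Proof.
move=> k_gt0; have k0 : k%:R != 0 :> R by rewrite pnatr_eq0 -lt0n.
split=> [[u /bodyE cu <-]|cv].
  by have := coneZ (ler0n R k) cu; rewrite mulr1.
exists (k%:R^-1 *: v); last by rewrite scalerA divff ?scale1r.
apply/bodyE; have := coneZ (_ : 0 <= k%:R^-1) cv; rewrite mulVf //; apply.
by rewrite invr_ge0.
Qed.

Lemma body0 : body 0.
Proof.
rewrite (_ : 0 = row_point 0 0 zero_seq).
  by apply: sub_convex_hull; rewrite /= !mem_cat inE eqxx.
by apply/rowP => -[[|[|j]] ltj]; rewrite !mxE.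
Qed.

Lemma body_delta (j : 'I_d.+2) : body (delta_mx ord0 j).
Proof.
have e_ge0 : 0 <= e%:R :> R by exact: ler0n.
have q_ge0 : 0 <= q%:R :> R by exact: ler0n.
have eS : e.+1%:R = e%:R + 1 :> R by rewrite natr1.
have deltaE : delta_mx ord0 j = row_point (j == 0%N :> nat)%:R (j == 1%N :> nat)%:R
    (fun i => (i.+2 == j)%:R).
  by apply/rowP => -[[|[|i]] lti]; rewrite !mxE -val_eqE /= // eq_sym.
rewrite deltaE; case: j {deltaE} => -[|[|j]] ltj /=.
- by apply: slice_body; rewrite /slice eS; split; split; nra.
- by apply: slice_body; rewrite /slice eS; split; split; nra.
rewrite (eq_point _ _ (z' := unit_seq j)) => [|i _]; last by rewrite !eqSS.
apply: sub_convex_hull; rewrite /= !mem_cat.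
by rewrite (map_f (fun i => row_point 0 0 (unit_seq i))) ?orbT // mem_iota.
Qed.

(** The body contains the origin and the standard basis, which affinely span the space: the origin
    takes the weight left over by the coordinates of [v]. *)
Lemma body_has_dim : has_dim body d.+2.
Proof.
exists 0, fullv; split; first by rewrite dimvf /dim /= mul1n.
apply/seteqP; split=> [v _|v _]; first by exists v; rewrite ?add0r //=; exact: memvf.
exists d.+3, (fun i => if unlift ord0 i is Some j then delta_mx ord0 j else 0),
  (fun i => if unlift ord0 i is Some j then v ord0 j else 1 - \sum_j v ord0 j).
split=> [i||].
- by case: unlift => [j|]; [exact: body_delta|exact: body0].
- rewrite big_ord_recl unlift_none -[RHS](subrK (\sum_j v ord0 j)).
  by congr (_ + _); apply: eq_bigr => j _; rewrite liftK.
rewrite big_ord_recl unlift_none scaler0 add0r.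
by under eq_bigr do rewrite liftK; rewrite -row_sum_delta.
Qed.

Lemma body_rational : rational_polytope body.
Proof.
split; first by exists [set` corners]; split; [exact: finite_seq|].
move=> v /vertex_convex_hull /= vc.
have rat_point x y z : (exists a, x = ratr a) -> (exists a, y = ratr a) ->
    (forall i, exists a, z i = ratr a) -> rational_point (row_point x y z).
  move=> xr yr zr [[|[|j]] ltj]; rewrite mxE /=; [exact: xr|exact: yr|exact: zr].
have nat_rat (n : nat) : exists a, n%:R = ratr a :> R by exists n%:R; rewrite ratr_nat.
have zero_rat i : exists a, zero_seq i = ratr a by exact: (nat_rat 0%N).
have unit_rat i j : exists a, unit_seq i j = ratr a by exact: nat_rat.
have r_rat : exists a, (2 * e%:R + 1) / e.+1%:R = ratr a :> R.
  exists ((2 * e%:R + 1) / e.+1%:R).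
  by rewrite fmorph_div rmorphD rmorphM rmorph1 /= !ratr_nat.
have q_rat : exists a, q%:R^-1 = ratr a :> R.
  by exists q%:R^-1; rewrite fmorphV /= ratr_nat.
have [rat0 rat1] := (nat_rat 0%N, nat_rat 1%N).
move: vc; rewrite !mem_cat !inE -!orbA.
do 6! (move=> /orP[/eqP ->|]; first by apply: rat_point).
by move=> /orP[] /mapP[i _ ->]; apply: rat_point.
Qed.

End Polytope.

(** * Lattice points of the dilates *)

Lemma slice_nat (R : realType) (e q k m x y : nat) : (0 < q)%N ->
  slice e q (k%:R : R) m%:R x%:R y%:R <->
  [&& y <= k + e.+1 * m, row_low e q k m y <= x & x <= row_high e k m y]%N.
Proof.
move=> q_gt0; rewrite /slice !ler0n.
have -> : 2 * e%:R + 1 = e.*2.+1%:R :> R by rewrite -[in RHS]natr1 -mul2n natrM.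
rewrite -natrX -!natrM -!natrD !ler_nat /row_low /row_high cdiv_leq //.
rewrite leq_divRL ?expn_gt0 // leq_subLR expnS expn1.
(* One floor encodes both right-hand facets: for [y <= k] the vertical one implies the slanted one,
   for [y > k] conversely, and there [e * (y - k)] is small enough for the outer subtraction not to
   truncate. *)
have key : (y <= k + e.+1 * m)%N ->
    (x * (e.+1 * e.+1) <= e.+1 * (e.*2.+1 * m) - e * (y - k))%N =
    ((e.+1 * x <= e.*2.+1 * m) &&
     (e.+1 * e.+1 * x + e * y <= e.+1 * e.*2.+1 * m + e * k))%N.
  move=> ley; have [leyk|ltky] := leqP y k.
    have -> : (y - k = 0)%N by lia.
    rewrite muln0 subn0 mulnC -mulnA leq_pmul2l //.
    have [le1 /=|//] := boolP (e.+1 * x <= e.*2.+1 * m)%N.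
    by symmetry; rewrite -!mulnA leq_add ?leq_mul2l ?le1 ?leyk ?orbT.
  have [u uE] : exists u, (y = k + u)%N by exists (y - k)%N; lia.
  rewrite {}uE addKn leq_add2l in ley ltky *.
  have le2 : (e * u <= e.+1 * (e.*2.+1 * m))%N.
    by rewrite -muln2; nia.
  apply/idP/andP => [H|[H1 H2]]; last by lia.
  split; last by lia.
  by rewrite -(leq_pmul2l (ltn0Sn e)); lia.
split=> [[[_ _ c1] [c2 c3 c4]]|/and3P[c1 c2 c3]].
  by rewrite c1 c2 key // c3 c4.
by rewrite key // in c3; case/andP: c3.
Qed.

Section LatticePoints.
Variables (R : realType) (d e q : nat).
Hypothesis q_gt0 : (0 < q)%N.

Definition row_points (k m : nat) : seq (nat * nat) :=
  [seq (x, y) | y <- iota 0 (k + e.+1 * m).+1,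
                x <- iota (row_low e q k m y) (row_size e q k m y)].

Definition lattice_points (k : nat) : seq (seq nat) :=
  [seq p.1 :: p.2 :: z | z <- bounded_seqs d k, p <- row_points k (k - sumn z)].

Definition vector_of_seq (s : seq nat) : 'rV[R]_d.+2 :=
  \row_j (nth 0%N s j)%:R.

Lemma mem_row_points k m x y : ((x, y) \in row_points k m) =
  [&& y <= k + e.+1 * m, row_low e q k m y <= x & x <= row_high e k m y]%N.
Proof.
apply/allpairsPdep/and3P => [[y' [x' [+ + [-> ->]]]]|[c1 c2 c3]].
  by rewrite !mem_iota /row_size => ? ?; split; lia.
by exists y, x; rewrite !mem_iota /row_size; split=> //; lia.
Qed.

Lemma lattice_points_uniq k : uniq (lattice_points k).
Proof.
apply: allpairs_uniq_dep; first exact: bounded_seqs_uniq.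
  move=> z _; apply: allpairs_uniq_dep; first exact: iota_uniq.
    by move=> y _; exact: iota_uniq.
  by move=> [y x] [y' x'] _ _ /= [-> ->].
by move=> [z [x y]] [z' [x' y']] _ _ /= [-> -> ->].
Qed.

Lemma lattice_pointsP k s : reflect
  (exists x y z, [/\ s = [:: x, y & z], size z = d, (sumn z <= k)%N &
     (x, y) \in row_points k (k - sumn z)]) (s \in lattice_points k).
Proof.
apply: (iffP allpairsPdep) => [[z [[x y] [+ rp ->]]]|[x [y [z [-> sz lez rp]]]]].
  by rewrite mem_bounded_seqs => /andP[/eqP sz lez]; exists x, y, z.
by exists z, (x, y); rewrite mem_bounded_seqs sz eqxx.
Qed.

Lemma vector_of_seq_inj k : {in lattice_points k &, injective vector_of_seq}.
Proof.
move=> s s' /lattice_pointsP[x [y [z [sE sz _ _]]]].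
move=> /lattice_pointsP[x' [y' [z' [sE' sz' _ _]]]] /rowP eqv.
apply: (@eq_from_nth _ 0%N); rewrite sE sE' /= sz ?sz' // => i lti.
have := eqv (Ordinal lti); rewrite !mxE sE sE' /= => /eqP.
by rewrite eqr_nat => /eqP.
Qed.

Lemma vector_of_seqE x y z :
  vector_of_seq [:: x, y & z] = row_point d x%:R y%:R (fun i => (nth 0%N z i)%:R).
Proof. by apply/rowP => -[[|[|j]] ltj]; rewrite !mxE. Qed.

Lemma height_nat (k : nat) (x y : R) z : size z = d -> (sumn z <= k)%N ->
  height k%:R (row_point d x y (fun i => (nth 0%N z i)%:R)) = (k - sumn z)%:R.
Proof.
move=> sz lez; rewrite /height natrB // sumnE (big_nth 0%N) sz big_mkord natr_sum.
by congr (_ - _); apply: eq_bigr => i _; rewrite row_entry_pointS.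
Qed.

Lemma lattice_pointsE (k : nat) : (0 < k)%N ->
  dilate k (@body R d e q) `&` @integer_points R d.+2 =
  [set` [fset s in map vector_of_seq (lattice_points k)]%fset].
Proof.
move=> k_gt0; apply/seteqP; split=> [v [/(dilate_body e q_gt0 _ k_gt0) cv iv]|v] /=.
  have [z_ge0 h_ge0 sl] := cv; have [[x_ge0 y_ge0 _] _] := sl.
  have natE j : 0 <= row_entry v j -> (Num.truncn (row_entry v j))%:R = row_entry v j.
    by move=> ge0; rewrite Num.Theory.truncnK // natrEint ge0 andbT iv.
  pose z := mkseq (fun i => Num.truncn (row_entry v i.+2)) d.
  have sz : size z = d by rewrite size_mkseq.
  have zE i : (i < d)%N -> (nth 0%N z i)%:R = row_entry v i.+2.
    by move=> ltid; rewrite nth_mkseq // natE // z_ge0.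
  have vE : v = row_point d (row_entry v 0) (row_entry v 1) (fun i => (nth 0%N z i)%:R).
    by rewrite -[LHS]row_point_entry; apply: eq_point => i /zE.
  have lez : (sumn z <= k)%N.
    move: h_ge0; rewrite /height subr_ge0 -(ler_nat R).
    rewrite sumnE (big_nth 0%N) sz big_mkord natr_sum.
    by rewrite (eq_bigr _ (fun (i : 'I_d) _ => zE i (ltn_ord i))).
  move: sl; rewrite vE height_nat // -vE -(natE 0%N) // -(natE 1%N) //.
  move=> /(slice_nat _ _ _ _ _ _ q_gt0); rewrite -mem_row_points => rp.
  rewrite !inE; apply/mapP; exists [:: Num.truncn (row_entry v 0), Num.truncn (row_entry v 1) & z].
    by apply/lattice_pointsP; exists (Num.truncn (row_entry v 0)), (Num.truncn (row_entry v 1)), z.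
  by rewrite vector_of_seqE !natE.
rewrite !inE => /mapP[s /lattice_pointsP[x [y [z [-> sz lez rp]]]] ->].
split; last by move=> j; rewrite mxE; exact: intr_nat.
apply/(dilate_body e q_gt0 _ k_gt0); rewrite vector_of_seqE.
split=> [i ltid||]; rewrite ?height_nat ?row_entry_pointS ?row_entry_point0 ?row_entry_point1 //.
by apply/slice_nat => //; rewrite -mem_row_points.
Qed.

(** Sum [sum_row_size] over [z] with [sum_bounded_seqs]. The factor [k] is the same for all [z] and
    comes out; the partial sum already present in the last term makes the exponent [d.+1]. *)
Lemma ehrhart_body (k : nat) : (0 < k)%N ->
  (ehrhart (@body R d e q) k)%:R =
  k%:R * (iter d psum (fun m => 2 * m%:R + 1) k
          - iter d psum (fun m => (cdiv m e.+1)%:R) k)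
  + iter d psum (fun m => ((e.+1 * m).+1 * m.+1 + e * 'C(m, 2))%:R) k
  - iter d.+1 psum (fun m => (cdiv m q)%:R) k :> rat.
Proof.
move=> k_gt0; rewrite /ehrhart lattice_pointsE // set_fsetK card_fseq undup_id; last first.
  by rewrite (map_inj_in_uniq (@vector_of_seq_inj k)) lattice_points_uniq.
rewrite size_map size_allpairs_dep sumnE big_map natr_sum iterSr.
rewrite -!sum_bounded_seqs -sumrB mulr_sumr -big_split /= -sumrB.
apply: eq_bigr => z _; set m := (k - sumn z)%N.
rewrite size_allpairs_dep sumnE big_map -[iota _ _]/(index_iota 0 (k + e.+1 * m).+1).
rewrite big_mkord; under eq_bigr do rewrite size_iota.
by rewrite sum_row_size.
Qed.

End LatticePoints.

(** * Reading off the coefficient functions *)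

Lemma iter_psum_polynomial d N f :
  polynomial_of_size N f -> polynomial_of_size (d + N) (iter d psum f).
Proof. by move=> Pf; elim: d => // d IH; exact: psum_polynomial. Qed.

Lemma iter_psum_quasi_constant_period d N p f : (0 < N)%N ->
  quasi_constant_period N p f -> quasi_constant_period (d + N) p (iter d psum f).
Proof.
move=> N_gt0 Pf; elim: d => // d IH; apply: psum_quasi_constant_period => //.
by rewrite addn_gt0 N_gt0 orbT.
Qed.

Lemma min_period_const (a : rat) : min_period (fun=> a) 1.
Proof. by split=> // q []. Qed.

Lemma min_period_subl (a : rat) c p :
  min_period c p -> min_period (fun k => a - c k) p.
Proof.
move=> [[p_gt0 cp] cmin]; split; first by split=> // k; rewrite cp.
move=> q [q_gt0 cq]; apply: cmin; split=> // k.
by have /addrI/oppr_inj := cq k.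
Qed.

Theorem theorem1 (R : realType) (n : nat) (hn : (2 <= n)%N)
    (p0 p1 : nat) (hp0 : (0 < p0)%N) (hp1 : (0 < p1)%N) :
  exists P : set 'rV[R]_n,
    rational_polytope P /\ has_dim P n /\
    period_sequence P (fun i : 'I_n.+1 =>
      if nat_of_ord i == 0%N then p0
      else if nat_of_ord i == 1%N then p1 else 1%N).
Proof.
case: n hn => [|[|d]] // _; case: p1 hp1 => // e _.
exists (@body R d e p0); split; first exact: body_rational.
split; first exact: body_has_dim.
have [P1 [s1 E1]] : polynomial_of_size (d + 2) (iter d psum (fun m => 2 * m%:R + 1)).
  apply: iter_psum_polynomial; exists (Poly [:: 1; 2]).
  by split=> [|k]; [exact: size_Poly|rewrite horner_Poly /=; ring].
have [P3 [s3 E3]] : polynomial_of_size (d + 3)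
    (iter d psum (fun m => ((e.+1 * m).+1 * m.+1 + e * 'C(m, 2))%:R)).
  apply: iter_psum_polynomial.
  (* Coefficients of the expansion of [((e + 1) m + 1) (m + 1) + e m (m - 1) / 2]. *)
  exists (Poly [:: 1; e.+2%:R - e%:R / 2; e.+1%:R + e%:R / 2]).
  split=> [|k]; [exact: size_Poly|rewrite horner_Poly /=].
  have binE : ('C(k, 2))%:R = k%:R * (k%:R - 1) / 2 :> rat.
    elim: k => [|k IHk]; first by rewrite bin0n !mul0r.
    by rewrite binS bin1 natrD IHk -natr1; field.
  by rewrite natrD !natrM binE; field.
have [P2 [c2 [s2 m2 E2]]] := iter_psum_quasi_constant_period d (isT : (0 < 2)%N)
  (cdiv_quasi_constant_period (ltn0Sn e)).
have [P4 [c4 [s4 m4 E4]]] := iter_psum_quasi_constant_period d.+1 (isT : (0 < 2)%N)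
  (cdiv_quasi_constant_period hp0).
(* [W] gathers all polynomial parts, the factor [k] becoming ['X]; its degree is at most the
   dimension [d.+2]. *)
pose W := (P1 - P2) * 'X + P3 - P4.
have sW : (size W <= d.+3)%N.
  have szD (p q : {poly rat}) N :
      (size p <= N)%N -> (size q <= N)%N -> (size (p + q)%R <= N)%N.
    by move=> sp sq; rewrite (leq_trans (size_polyD _ _)) // geq_max sp.
  have szX (p : {poly rat}) N : (size p <= N)%N -> (size (p * 'X)%R <= N.+1)%N.
    move=> sp; rewrite (leq_trans (size_polyMleq _ _)) // size_polyX.
    by rewrite addn2 ltnS.
  rewrite addn2 in s1 s2; rewrite addSn addn2 in s4; rewrite addn3 in s3.
  apply: (szD); rewrite ?size_polyN //; apply: (szD) => //.
  by apply: (szX); apply: (szD); rewrite ?size_polyN.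
(* The periodic part [c2] carries the factor [k] and so sits in degree 1, while [c4] sits in degree
   0. *)
pose c (i : 'I_d.+3) (k : int) : rat := W`_i -
  (if val i == 0%N then c4 k else if val i == 1%N then c2 k else 0).
have mc i : min_period (c i)
    (if val i == 0%N then p0 else if val i == 1%N then e.+1 else 1%N).
  rewrite /c; case: eqP => _; first exact: min_period_subl.
  case: eqP => _; first exact: min_period_subl.
  exact: min_period_const.
exists c; split; last exact: mc.
split=> [i|k k_gt0]; first by have [? _] := mc i; eexists; eassumption.
rewrite ehrhart_body // E1 E2 E3 E4.
transitivity (W.[k%:R] - k%:R * c2 k%:Z - c4 k%:Z).
  by rewrite /W !(hornerD, hornerN, hornerM, hornerX); ring.
rewrite (horner_coef_wide _ sW) /c.
rewrite [in LHS]big_ord_recl [in LHS]big_ord_recl.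
rewrite [RHS]big_ord_recl [X in _ = _ + X]big_ord_recl /=.
under [X in _ = _ + (_ + X)]eq_bigr do rewrite subr0.
by rewrite !expr0 !expr1; ring.
Qed.
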